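(* Let $T\subset\mathbb{R}$ with $0\in T$. Suppose that there is a constant $C<\infty$ such that every orthogonal process $X(t)$, $t\in T$ (on any probability space), satisfies $$\mathbf{E}\sup_{t\in T}|X(t)-X(0)|^2\leq C .$$ Then there is a constant $K<\infty$ (allowed to depend on $T$) such that $$\mathcal{M}\leq K\,D(T),$$ where $$\mathcal{M}=\sup_{\mu}\int_T\int_0^{\sqrt{D(T)}}\bigl(\mu(B(t,r^2))\bigr)^{-1/2}\,dr\,\mu(dt),$$ the supremum being taken over all Borel probability measures $\mu$ on $T$.
   Context: $D(T)=\sup_{s,t\in T}|s-t|$ and $B(t,r)=\{s\in T: |s-t|\leq r\}$. A real-valued process $X(t)$, $t\in T$, on a probability space is called orthogonal (a process with orthogonal increments) if $\mathbf{E}(X(s)-X(t))^2=|s-t|$ for all $s,t\in T$. If $T$ is uncountable, the expectation of a supremum over $T$ is understood as the supremum of the expectations of the suprema over finite subsets of $T$ (containing $0$). We use the convention $0^{-1/2}=+\infty$. *)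

(* Defs.v *)
From HB Require Import structures.
From mathcomp Require Import all_boot all_order all_algebra.
From mathcomp Require Import all_classical all_reals all_analysis.

Set Implicit Arguments.
Unset Strict Implicit.
Unset Printing Implicit Defensive.

Import Order.TTheory GRing.Theory Num.Theory.
Import numFieldNormedType.Exports.

Local Open Scope classical_set_scope.
Local Open Scope ring_scope.
Local Open Scope ereal_scope.

(* The set T as a type of its own, with the subspace topology and with
   0 \in T as its distinguished point, so that [point] denotes time 0. *)
Definition index_set (R : realType) (T : set R) (T0 : T 0%R) : Type :=
  set_type T.

Section index_set_instances.
Variables (R : realType) (T : set R) (T0 : T 0%R).
HB.instance Definition _ := Topological.copy (index_set T0) (set_type T).
HB.instance Definition _ :=
  isPointed.Build (index_set T0) (SigSub (mem_set T0) : set_type T).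
End index_set_instances.

Lemma index_set_pointE (R : realType) (T : set R) (T0 : T 0%R) :
  \val (point : index_set T0) = 0%R.
Proof. by []. Qed.

(* T is not assumed to be a Borel subset of R: measures live on the
   sigma-algebra generated by the relatively open subsets of T. *)
Definition borel_index_set (R : realType) (T : set R) (T0 : T 0%R) :=
  g_sigma_algebraType (@open (index_set T0)).

Definition diam (R : realType) (T : set R) : \bar R :=
  ereal_sup [set `|s - t|%:E | s in T & t in T].

Definition cball (R : realType) (T : set R) (T0 : T 0%R)
    (t : index_set T0) (r : R) : set (index_set T0) :=
  [set s | `|\val s - \val t| <= r]%R.

Definition orthogonal_process (R : realType) (T : set R) (T0 : T 0%R)
    (d : measure_display) (Omega : measurableType d) (P : probability Omega R)
    (X : index_set T0 -> {RV P >-> R}) : Prop :=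
  forall s t : index_set T0,
    'E_P[fun w => (X s w - X t w) ^+ 2]%R = `|\val s - \val t|%:E.

Definition expected_sup_on (R : realType) (T : set R) (T0 : T 0%R)
    (d : measure_display) (Omega : measurableType d) (P : probability Omega R)
    (X : index_set T0 -> {RV P >-> R}) (F : set (index_set T0)) : \bar R :=
  \int[P]_w ereal_sup [set (`|X t w - X point w| ^+ 2)%R%:E | t in F].

(* For uncountable T the supremum need not be measurable, so its expectation
   is by convention the supremum over the finite subsets containing 0. *)
Definition expected_sup (R : realType) (T : set R) (T0 : T 0%R)
    (d : measure_display) (Omega : measurableType d) (P : probability Omega R)
    (X : index_set T0 -> {RV P >-> R}) : \bar R :=
  if `[< countable T >] then expected_sup_on X [set: index_set T0]
  else ereal_sup [set expected_sup_on X F |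
                   F in [set F | finite_set F /\ F point]].

(* In \bar R, 0^-1 = +oo. *)
Definition majorizing_integral (R : realType) (T : set R) (T0 : T 0%R)
    (mu : probability (borel_index_set T0) R) : \bar R :=
  \int[mu]_t
    \int[lebesgue_measure]_(r in [set r : R | 0 <= r%:E <= sqrte (diam T)])
      (sqrte (mu (cball t (r ^+ 2)%R)))^-1.

Definition majorizing_sup (R : realType) (T : set R) (T0 : T 0%R) : \bar R :=
  ereal_sup [set majorizing_integral mu |
              mu in [set: probability (borel_index_set T0) R]].

(* Main.v *)
Require Import Defs.
From HB Require Import structures.
From mathcomp Require Import all_boot all_order all_algebra.
From mathcomp Require Import all_classical all_reals all_analysis.
From mathcomp Require Import measurable_realfun.
From mathcomp Require Import ring lra zify.

(* Rescale T into [0, 1) and consider the 4-adic intervals I of level k, with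
   masses m(I) under a probability mu on T. Up to a constant the majorizing
   integral of mu is the sum of the level sums S_k = 2^-k sum_I sqrt(m(I)).

   Let m0, .., m3 be the masses of the children of I. As long as they are not
   nearly equal, 2^-k sqrt(m(I)) is at most a constant times the contribution
   of I to S_k - S_(k+1), which telescopes. Otherwise sqrt(m(I)) is comparable
   to sqrt(m1 m3 / (m1 + m3)), and it suffices to bound the sum over all I of
   2^-k sqrt(m1 m3 / (m1 + m3)).

   To this end let f_I be the Haar function of L^2(dx) carried by the children
   0 and 2 of I, and h_I the Haar function of L^2(mu) carried by the children 1
   and 3. Both systems are orthonormal, so t |-> sum_I <1_[0,t], f_I> h_I is the
   image of t |-> 1_[0,t] under a partial isometry. The orthogonal complement
   1_[0,t] - sum_I <1_[0,t], f_I> f_I, placed on a disjoint part of the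
   probability space, turns it into an orthogonal process. Now <1_[0,t], f_I>
   is a positive constant on child 1 and vanishes on child 3; evaluating the
   process at a random time of law mu therefore gives exactly a multiple of
   the required sum, which the hypothesis bounds by the square root of C. *)

Set Implicit Arguments.
Unset Strict Implicit.
Unset Printing Implicit Defensive.

Import Order.TTheory GRing.Theory Num.Theory.
Import numFieldNormedType.Exports.

Local Open Scope classical_set_scope.
Local Open Scope ring_scope.

(** * Haar systems *)

Definition orthonormal_on (R : realType) (I J : finType) (w : I -> R)
    (A : {set J}) (f : J -> I -> R) :=
  {in A &, forall a b, \sum_i w i * (f a i * f b i) = (a == b)%:R}.

Lemma parseval (R : realType) (I J : finType) (w : I -> R) (A : {set J})
    (f : J -> I -> R) (c : J -> R) : orthonormal_on w A f ->
  \sum_i w i * (\sum_(a in A) c a * f a i) ^+ 2 = \sum_(a in A) c a ^+ 2.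
Proof.
move=> orth.
transitivity (\sum_i \sum_(a in A) \sum_(b in A)
    c a * c b * (w i * (f a i * f b i))).
  apply: eq_bigr => i _; rewrite expr2 mulr_suml mulr_sumr.
  apply: eq_bigr => a _; rewrite 2!mulr_sumr.
  by apply: eq_bigr => b _; ring.
rewrite exchange_big; apply: eq_bigr => a aA; rewrite exchange_big /=.
under eq_bigr => b bA do rewrite -mulr_sumr orth//.
rewrite (bigD1 a)//= eqxx mulr1 big1 ?addr0//.
by move=> b /andP[_ /negPf ba]; rewrite eq_sym ba mulr0.
Qed.

(* Here [1_S - v] is the residual of the indicator of a set S with masses [l i]
   in the cells after its projection v on the step functions [f a]. *)
Lemma sqnorm_residual (R : realType) (I J : finType) (w l : I -> R)
    (A : {set J}) (f : J -> I -> R) (c : J -> R)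
    (v := fun i => \sum_(a in A) c a * f a i) :
  orthonormal_on w A f ->
  {in A, forall a, c a = \sum_i f a i * l i} ->
  \sum_i ((1 - v i) ^+ 2 * l i + v i ^+ 2 * (w i - l i)) =
  \sum_i l i - \sum_(a in A) c a ^+ 2.
Proof.
move=> orth cE.
have vl : \sum_i v i * l i = \sum_(a in A) c a ^+ 2.
  under eq_bigr do rewrite /v mulr_suml.
  rewrite exchange_big; apply: eq_bigr => a aA.
  rewrite expr2 [X in _ = _ * X](cE a aA) mulr_sumr.
  by apply: eq_bigr => i _; rewrite mulrA.
transitivity (\sum_i (l i - 2 * (v i * l i) + w i * v i ^+ 2)).
  by apply: eq_bigr => i _; ring.
by rewrite !big_split /= sumrN -mulr_sumr vl (parseval _ orth); ring.
Qed.

Section haar.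
Variables (R : realType) (N : nat) (w : 'I_(4 ^ N) -> R).
Implicit Types (k i b : nat) (j : 'I_(4 ^ N)).

(* Leaves are the cells of level [N]; cell [i] of level [k] has the children
   [4 * i + b], [b < 4], of level [k.+1]. *)
Definition ancestor k (j : nat) : nat := (j %/ 4 ^ (N - k))%N.

Definition cell_mass k i : R := \sum_j w j * (ancestor k j == i)%:R.

Lemma ancestor_le k l (j : nat) : (k <= l <= N)%N ->
  ancestor k j = (ancestor l j %/ 4 ^ (l - k))%N.
Proof.
move=> /andP[kl lN]; rewrite /ancestor -divnMA -expnD; congr (_ %/ 4 ^ _)%N; lia.
Qed.

Lemma ancestorS k (j : nat) : (k < N)%N -> ancestor k j = (ancestor k.+1 j %/ 4)%N.
Proof. by move=> kN; rewrite (@ancestor_le k k.+1) ?leqnSn// subSnn expn1. Qed.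

(** The children are parameters because the system is used twice: with 0 and 2 for uniform weights,
    with 1 and 3 for the masses of [mu]. The values [al] and [be] stay free, since mean zero and
    unit norm depend on the weights. *)
Definition haar (b1 b2 : nat) (al be : R) k i (j : 'I_(4 ^ N)) : R :=
  al * (ancestor k.+1 j == 4 * i + b1)%:R - be * (ancestor k.+1 j == 4 * i + b2)%:R.

Section fixed_children.
Variables (b1 b2 : nat).
Hypotheses (b1_lt4 : (b1 < 4)%N) (b2_lt4 : (b2 < 4)%N) (b12 : b1 != b2).

Lemma haar_out al be k i j : (k < N)%N -> ancestor k j != i ->
  haar b1 b2 al be k i j = 0.
Proof.
move=> kN anci.
have child b : (b < 4)%N -> (ancestor k.+1 j == 4 * i + b)%N = false.
  move=> b4; apply/negP => /eqP jb; move: anci.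
  by rewrite (ancestorS _ kN) jb mulnC divnMDl// divn_small// addn0 eqxx.
by rewrite /haar !child// !mulr0 subrr.
Qed.

Lemma sum_haar al be k i :
  \sum_j w j * haar b1 b2 al be k i j =
  al * cell_mass k.+1 (4 * i + b1) - be * cell_mass k.+1 (4 * i + b2).
Proof.
rewrite /cell_mass !mulr_sumr -sumrB; apply: eq_bigr => j _.
by rewrite /haar; ring.
Qed.

Lemma sum_haar_sqr al be k i :
  \sum_j w j * (haar b1 b2 al be k i j * haar b1 b2 al be k i j) =
  al ^+ 2 * cell_mass k.+1 (4 * i + b1) + be ^+ 2 * cell_mass k.+1 (4 * i + b2).
Proof.
rewrite /cell_mass !mulr_sumr -big_split /=; apply: eq_bigr => j _.
rewrite /haar; case: eqP => [->|_]; last by case: eqP => _ /=; ring.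
by rewrite eqn_add2l (negPf b12) /=; ring.
Qed.

(** The coarser function is constant on the cell [m] that carries the finer one, and the finer one
    has mean zero. *)
Lemma haar_orth_lt al be al' be' k i l m : (k < l < N)%N ->
  al' * cell_mass l.+1 (4 * m + b1) = be' * cell_mass l.+1 (4 * m + b2) ->
  \sum_j w j * (haar b1 b2 al be k i j * haar b1 b2 al' be' l m j) = 0.
Proof.
move=> /andP[kl lN] mean0.
(* The value of the coarser function on cell [m], read off from the ancestor of [m] at level
   [k.+1]. *)
pose c := al * ((m %/ 4 ^ (l - k.+1)) == 4 * i + b1)%N%:R -
          be * ((m %/ 4 ^ (l - k.+1)) == 4 * i + b2)%N%:R.
transitivity (\sum_j c * (w j * haar b1 b2 al' be' l m j)).
  apply: eq_bigr => j _; have [ancm|ancm] := eqVneq (ancestor l j) m; last first.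
    by rewrite (haar_out _ _ lN ancm) !mulr0.
  rewrite {1}/haar (@ancestor_le k.+1 l) ?kl 1?ltnW// ancm -/c; ring.
by rewrite -mulr_sumr sum_haar mean0 subrr mulr0.
Qed.

(** Different levels are handled by [haar_orth_lt]; distinct cells of one level carry functions of
    disjoint support. *)
Lemma haar_orthonormal (J : finType) (A : {set J}) (lv ix : J -> nat)
    (al be : J -> R) : injective (fun a => (lv a, ix a)) ->
  (forall a, (lv a < N)%N) ->
  {in A, forall a, al a * cell_mass (lv a).+1 (4 * ix a + b1) =
                   be a * cell_mass (lv a).+1 (4 * ix a + b2)} ->
  {in A, forall a, al a ^+ 2 * cell_mass (lv a).+1 (4 * ix a + b1) +
                   be a ^+ 2 * cell_mass (lv a).+1 (4 * ix a + b2) = 1} ->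
  orthonormal_on w A (fun a => haar b1 b2 (al a) (be a) (lv a) (ix a)).
Proof.
move=> inj lvN mean0 norm1 a b aA bA.
have [->|ab] := eqVneq a b; first by rewrite sum_haar_sqr norm1.
have [lab|lba|lvE] := ltngtP (lv a) (lv b).
- by rewrite haar_orth_lt ?lab ?lvN//; exact: mean0.
- under eq_bigr do rewrite (mulrC (haar _ _ _ _ (lv a) _ _)).
  by rewrite haar_orth_lt ?lba ?lvN//; exact: mean0.
- have ixab : ix a != ix b.
    by apply: contra ab => /eqP ixE; apply/eqP/inj; rewrite lvE ixE.
  rewrite big1// => j _; have [ja|ja] := eqVneq (ancestor (lv a) j) (ix a); last first.
    by rewrite (haar_out _ _ (lvN a) ja) mul0r mulr0.
  by rewrite [haar b1 b2 (al b) _ _ _ _]haar_out ?mulr0 -?lvE ?ja// lvE.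
Qed.

End fixed_children.
End haar.

(** * A process with atoms and a uniform part *)

Section atoms_and_uniform.
Local Open Scope ereal_scope.

(** The witness is the equal mixture of the discrete law [p] and the uniform law on [0, 1]; the
    atoms are negative and so avoid [0, 1]. *)
Lemma exists_atoms_uniform (R : realType) (n : nat) (p : nat -> R) :
  (forall j, (0 <= p j)%R) -> (\sum_(j < n) p j = 1)%R ->
  exists P : probability (measurableTypeR R) R,
    (forall j, (j < n)%N -> P [set (- j.+1%:R)%R] = (p j / 2)%:E) /\
    (forall A : set (measurableTypeR R), measurable A ->
      A `<=` `[0%R, 1%R] -> P A = (2^-1)%:E * lebesgue_measure A).
Proof.
move=> p0 p1.
have h0 : (0 <= 2^-1 :> R)%R by rewrite invr_ge0.
have m01 : measurable (`[0%R, 1%R]%classic : set (measurableTypeR R)) by [].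
pose mu : {measure set (measurableTypeR R) -> \bar R} :=
  msum (fun j => mscale (NngNum (p0 j)) (dirac (- j.+1%:R : measurableTypeR R)%R)) n.
pose m : {measure set (measurableTypeR R) -> \bar R} :=
  measure_add (mscale (NngNum h0) mu)
              (mscale (NngNum h0) (mrestr lebesgue_measure m01)).
have mE A : m A = (2^-1)%:E * (\sum_(j < n) (p j)%:E * \d_(- j.+1%:R : R)%R A)
    + (2^-1)%:E * lebesgue_measure (A `&` `[0%R, 1%R]).
  by rewrite /m [LHS]measure_addE.
have mT : m setT = 1.
  rewrite mE setTI lebesgue_measure_itv /= lte_fin ltr01 sube0 mule1.
  under eq_bigr do rewrite diracT mule1.
  by rewrite sumEFin p1 -EFinM -EFinD; congr (_%:E); lra.
pose P : probability (measurableTypeR R) R :=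
  HB.pack_for (probability (measurableTypeR R) R)
    (Measure.sort m) (@Measure_isProbability.Build _ _ _ m mT).
exists P; split => [j jn|A mA A01].
- rewrite [LHS]mE (_ : _ `&` _ = set0) ?measure0 ?mule0 ?adde0; last first.
    apply/seteqP; split => // x [/= ->]; rewrite in_itv /= => /andP[].
    by rewrite oppr_ge0 leNgt ltr0Sn.
  rewrite (bigD1 (Ordinal jn))//= big1 => [|i /eqP ij].
    by rewrite diracE mem_set// mule1 adde0 -EFinM mulrC.
  rewrite diracE memNset ?mule0// => /= /oppr_inj /eqP; rewrite eqr_nat => /eqP[] ji.
  by apply: ij; apply/val_inj.
- rewrite [LHS]mE setIidl// big1 ?mule0 ?add0e// => j _.
  rewrite diracE memNset ?mule0// => /A01 /=; rewrite in_itv/= => /andP[].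
  by rewrite oppr_ge0 leNgt ltr0Sn.
Qed.

Lemma sqr_sum_disjoint (R : realType) (I : finType) (F : I -> R) :
  (forall i j, i != j -> F i * F j = 0)%R ->
  ((\sum_i F i) ^+ 2 = \sum_i F i ^+ 2)%R.
Proof.
move=> F0; rewrite expr2 mulr_suml; apply: eq_bigr => i _.
rewrite mulr_sumr (bigD1 i)//= big1 ?addr0// => j ji.
by rewrite F0// eq_sym.
Qed.

Lemma ge0_integral_sum_indic d (Om : measurableType d) (R : realType)
    (mu : {measure set Om -> \bar R}) n (c : 'I_n -> R) (A : 'I_n -> set Om) :
  (forall j, (0 <= c j)%R) -> (forall j, measurable (A j)) ->
  \int[mu]_x (\sum_j c j * \1_(A j) x)%:E = \sum_j (c j)%:E * mu (A j).
Proof.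
move=> c0 mA; under eq_integral do rewrite -sumEFin.
rewrite ge0_integral_sum//.
- apply: eq_bigr => j _; under eq_integral do rewrite EFinM.
  rewrite ge0_integralZl_EFin//.
  + by rewrite integral_indic// setIT.
  + exact/measurable_EFinP.
- by move=> j; apply/measurable_EFinP; apply: measurable_funM.
- by move=> j x _; rewrite lee_fin mulr_ge0.
Qed.

End atoms_and_uniform.

Section step_process.
Local Open Scope ereal_scope.
Local Open Scope ring_scope.
Variables (R : realType) (n : nat).
Implicit Types (a v : 'I_n -> R) (x y u : R) (j : 'I_n).

Definition cell (j : nat) : set R := `[j%:R / n%:R, j.+1%:R / n%:R[%classic.

Definition atom (j : nat) : set R := [set - j.+1%:R].

(* Lebesgue measure of [cell j `&` `[0, x[], for [0 <= x]. *)
Definition below_in_cell x (j : nat) : R :=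
  Num.min x (j.+1%:R / n%:R) - Num.min x (j%:R / n%:R).

(* The probability space is R: the atoms -1, .., -n carry the image of the
   partial isometry, the cells of [0, 1] the orthogonal remainder. *)
Definition step_rv a v x u : R :=
  \sum_j (a j * \1_(atom j) u + (\1_(`]-oo, x[%classic) u - v j) * \1_(cell j) u).

Lemma measurable_cell j : measurable (cell j : set (measurableTypeR R)).
Proof. exact: measurable_itv. Qed.

Lemma measurable_atom j : measurable (atom j : set (measurableTypeR R)).
Proof. exact: measurable_set1. Qed.

Lemma measurable_step_rv a v x :
  measurable_fun [set: measurableTypeR R] (step_rv a v x : measurableTypeR R -> R).
Proof.
apply: measurable_sum => j; apply: measurable_funD.
  by apply: measurable_funM => //; exact: measurable_indic (measurable_atom j).
apply: measurable_funM; last exact: measurable_indic (measurable_cell j).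
apply: measurable_funB => //; apply: measurable_indic; exact: measurable_itv.
Qed.

Lemma ord_bound_gt0 j : 0 < n%:R :> R.
Proof. by rewrite ltr0n; apply: leq_ltn_trans (ltn_ord j). Qed.

Lemma cell_subset01 j : cell j `<=` `[0, 1].
Proof.
move=> u; rewrite /cell /= !in_itv /= => /andP[ju uj].
apply/andP; split; first by apply: le_trans ju; rewrite divr_ge0.
apply/ltW/(lt_le_trans uj).
by rewrite ler_pdivrMr ?(ord_bound_gt0 j)// mul1r ler_nat.
Qed.

Lemma trivIset_cell i j u : i != j -> cell i u -> cell j u -> False.
Proof.
wlog ij : i j / (i < j)%N.
  move=> H; rewrite neq_lt => /orP[|] ij ci cj.
    by apply: (H i j) => //; rewrite neq_lt ij.
  by apply: (H j i) => //; rewrite neq_lt ij.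
move=> _; rewrite /cell /= !in_itv/= => /andP[_ ui] /andP[ju _].
have := le_lt_trans ju ui.
have n0 := ord_bound_gt0 i.
by rewrite ltr_pM2r ?invr_gt0// ltr_nat ltnS leqNgt ij.
Qed.

Lemma atom_notin_cell i j u : atom i u -> cell j u -> False.
Proof.
move=> /= -> /cell_subset01 /=; rewrite in_itv/= => /andP[].
by rewrite oppr_ge0 leNgt ltr0Sn.
Qed.

Lemma sum_atom_indic (c : 'I_n -> R) (i : 'I_n) :
  \sum_j c j * \1_(atom j) (- i.+1%:R) = c i.
Proof.
rewrite (bigD1 i)//= big1 ?addr0.
  by rewrite indicE mem_set// mulr1.
move=> j ji; rewrite indicE memNset ?mulr0// => /= /oppr_inj /eqP.
by rewrite eqr_nat => /eqP[] /val_inj /esym; exact/eqP.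
Qed.

Lemma step_rv_atom a v x (i : 'I_n) : step_rv a v x (- i.+1%:R) = a i.
Proof.
rewrite /step_rv big_split /= sum_atom_indic big1 ?addr0// => j _.
rewrite [X in _ * X]indicE memNset ?mulr0// => /(@atom_notin_cell i j); exact.
Qed.

(** Atoms and cells are pairwise disjoint, so all cross terms vanish. The difference of the two
    half-line indicators is 1 on [[x', x[] and 0 elsewhere, which splits each cell in two. *)
Lemma sqr_step_rvB a v x a' v' x' u : x' <= x ->
  (step_rv a v x u - step_rv a' v' x' u) ^+ 2 =
  \sum_j (a j - a' j) ^+ 2 * \1_(atom j) u +
  \sum_j (1 - (v j - v' j)) ^+ 2 * \1_(cell j `&` `[x', x[) u +
  \sum_j (v j - v' j) ^+ 2 * \1_(cell j `\` `[x', x[) u.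
Proof.
move=> x'x; rewrite /step_rv -sumrB.
have indicE0 (A B : set R) : (A u -> B u -> False) -> \1_A u * \1_B u = 0 :> R.
  move=> AB; rewrite !indicE; case: (boolP (u \in A)) => [|_]; last by rewrite mul0r.
  rewrite inE => /AB Bu; rewrite memNset ?mulr0//.
have E j : a j * \1_(atom j) u + (\1_(`]-oo, x[%classic) u - v j) * \1_(cell j) u -
    (a' j * \1_(atom j) u + (\1_(`]-oo, x'[%classic) u - v' j) * \1_(cell j) u) =
    (a j - a' j) * \1_(atom j) u +
    (\1_(`[x', x[%classic) u - (v j - v' j)) * \1_(cell j) u.
  suff -> : \1_(`[x', x[%classic) u =
            \1_(`]-oo, x[%classic) u - \1_(`]-oo, x'[%classic) u :> R by ring.
  rewrite !indicE !mem_setE /= !in_itv /=.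
  by case: (ltP u x') => ux' /=; [rewrite (lt_le_trans ux' x'x) subrr|rewrite subr0].
under eq_bigr do rewrite E.
rewrite sqr_sum_disjoint => [|i j ij].
  rewrite -!big_split /=; apply: eq_bigr => j _.
  have := indicE0 (atom j) (cell j) (@atom_notin_cell j j u).
  rewrite !indicE in_setI in_setD.
  by case: (_ \in atom _); case: (_ \in cell _); case: (_ \in _) => //=; lra.
have c1 := indicE0 _ _ (@trivIset_cell i j u ij).
have c2 := indicE0 _ _ (@atom_notin_cell i j u).
have c3 := indicE0 _ _ (@atom_notin_cell j i u).
have c4 : \1_(atom i) u * \1_(atom j) u = 0 :> R.
  apply: indicE0 => /= -> /oppr_inj /eqP; rewrite eqr_nat => /eqP[] /val_inj.
  exact/eqP.
rewrite mulrDl !mulrDr mulrACA c4 mulrACA c2 [X in _ + (X + _)]mulrACA.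
by rewrite [\1_(cell i) _ * _]mulrC c3 [X in _ + (_ + X)]mulrACA c1 !mulr0 !addr0.
Qed.

Lemma lebesgue_measure_cell j : lebesgue_measure (cell j) = (n%:R^-1)%:E :> \bar R.
Proof.
rewrite /cell lebesgue_measure_itv /= lte_fin.
have n0 := ord_bound_gt0 j.
rewrite ltr_pM2r ?invr_gt0// ltr_nat ltnSn -EFinB -mulrBl.
by rewrite -natrB ?leqnSn// subSnn mul1r.
Qed.

Lemma lebesgue_measure_cellI j x' x : x' <= x ->
  lebesgue_measure (cell j `&` `[x', x[) =
  (below_in_cell x j - below_in_cell x' j)%:E :> \bar R.
Proof.
move=> x'x.
have -> : cell j `&` `[x', x[ =
    `[Num.max (j%:R / n%:R) x', Num.min (j.+1%:R / n%:R) x[%classic.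
  apply/seteqP; split => u; rewrite /cell /= !in_itv /= ge_max lt_min.
    by move=> [/andP[-> ->] /andP[-> ->]].
  by move=> /andP[/andP[-> ->] /andP[-> ->]].
have jS : j%:R / n%:R <= j.+1%:R / n%:R :> R.
  by rewrite ler_wpM2r ?invr_ge0// ler_nat.
rewrite lebesgue_measure_itv /= lte_fin /below_in_cell -EFinB -[0%E]/(0%:E).
rewrite -(fun_if EFin); congr (_%:E).
set c := j%:R / _ in jS *; set d := j.+1%:R / _ in jS *.
case: (leP c x') => ?; case: (leP d x) => ?; case: (leP x' d) => ?;
  by case: (leP x c) => ? /=; try (case: ifPn; rewrite -?leNgt => ?); lra.
Qed.

(** The two sums have the shapes to which [parseval] and [sqnorm_residual] apply. *)
Lemma second_moment_step_rvB (p : nat -> R)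
    (P : probability (measurableTypeR R) R) a v x a' v' x' : x' <= x ->
  (forall j, (j < n)%N -> P (atom j) = (p j / 2)%:E) ->
  (forall A : set (measurableTypeR R), measurable A ->
      A `<=` `[0, 1] -> P A = ((2^-1)%:E * lebesgue_measure A)%E) ->
  let l j := below_in_cell x j - below_in_cell x' j in
  let w j := v j - v' j in
  'E_P[fun u => (step_rv a v x u - step_rv a' v' x' u) ^+ 2] =
  (2^-1 * (\sum_(j < n) p j * (a j - a' j) ^+ 2 +
    \sum_j ((1 - w j) ^+ 2 * l j + w j ^+ 2 * (n%:R^-1 - l j))))%:E.
Proof.
move=> x'x Patom Pcell l w; rewrite unlock.
under eq_integral do rewrite sqr_step_rvB// 2!EFinD.
have mI : measurable (`[x', x[%classic : set (measurableTypeR R)).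
  exact: measurable_itv.
have mA j := measurable_atom j.
have mCI j : measurable (cell j `&` `[x', x[ : set (measurableTypeR R)).
  exact: measurableI (measurable_cell j) mI.
have mCD j : measurable (cell j `\` `[x', x[ : set (measurableTypeR R)).
  exact: measurableD (measurable_cell j) mI.
have msum (c : 'I_n -> R) (A : 'I_n -> set (measurableTypeR R)) :
    (forall j, measurable (A j)) ->
    measurable_fun setT (fun u => (\sum_j c j * \1_(A j) u)%:E).
  move=> mA'; apply/measurable_EFinP; apply: measurable_sum => j.
  by apply: measurable_funM => //; exact: measurable_indic (mA' j).
have sum_ge0 (c : 'I_n -> R) (A : 'I_n -> set (measurableTypeR R)) u :
    (forall j, 0 <= c j) -> (0 <= (\sum_j c j * \1_(A j) u)%:E)%E.
  by move=> c0; rewrite lee_fin; apply: sumr_ge0 => j _; rewrite mulr_ge0.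
rewrite ge0_integralD//; last 4 first.
- by move=> u _; apply: adde_ge0; apply: sum_ge0 => j; exact: sqr_ge0.
- by apply: emeasurable_funD; exact: msum.
- by move=> u _; apply: sum_ge0 => j; exact: sqr_ge0.
- exact: msum.
rewrite ge0_integralD//; try exact: msum; last 2 first.
- by move=> u _; apply: sum_ge0 => j; exact: sqr_ge0.
- by move=> u _; apply: sum_ge0 => j; exact: sqr_ge0.
rewrite !ge0_integral_sum_indic; try by move=> j; rewrite ?sqr_ge0.
have PI j : P (cell j `&` `[x', x[) = (2^-1 * l j)%:E.
  rewrite Pcell// ?lebesgue_measure_cellI//.
  by apply: subset_trans (@cell_subset01 j); exact: subIsetl.
have PD j : P (cell j `\` `[x', x[) = (2^-1 * (n%:R^-1 - l j))%:E.
  have PC : P (cell j) = (2^-1 * n%:R^-1)%:E.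
    rewrite Pcell ?lebesgue_measure_cell//; first exact: measurable_cell.
    exact: cell_subset01.
  have PCoo : (P (cell j) < +oo)%E by rewrite PC ltry.
  rewrite [LHS](measureD (measurable_cell j) mI PCoo) [X in (X - _)%E]PC.
  rewrite [X in (_ - X)%E]PI -EFinB; congr (_%:E); ring.
transitivity ((\sum_j (a j - a' j) ^+ 2 * (p j / 2))%:E +
  (\sum_j (1 - w j) ^+ 2 * (2^-1 * l j))%:E +
  (\sum_j w j ^+ 2 * (2^-1 * (n%:R^-1 - l j)))%:E)%E.
  rewrite -!sumEFin; congr (_ + _ + _)%E; apply: eq_bigr => j _.
  - by rewrite [RHS]EFinM; congr (_ * _)%E; exact: Patom.
  - by rewrite [RHS]EFinM; congr (_ * _)%E; exact: PI.
  - by rewrite [RHS]EFinM; congr (_ * _)%E; exact: PD.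
rewrite -!EFinD -!big_split /=; congr (_%:E).
rewrite mulr_sumr; apply: eq_bigr => j _; ring.
Qed.

End step_process.

(** * Monotonicity of integrals and of expected suprema *)

Section pointwise_monotonicity.
Local Open Scope ereal_scope.

(* Unlike [ge0_le_integral], no measurability is assumed. *)
Lemma ge0_le_integral_pointwise d (Om : measurableType d) (R : realType)
    (mu : {measure set Om -> \bar R}) (D : set Om) (f g : Om -> \bar R) :
  (forall x, D x -> 0 <= f x) -> (forall x, D x -> f x <= g x) ->
  \int[mu]_(x in D) f x <= \int[mu]_(x in D) g x.
Proof.
move=> f0 fg; rewrite !ge0_integralE//; last first.
  by move=> x Dx; apply: le_trans (f0 _ Dx) (fg _ Dx).
apply: le_ereal_sup => _ [k /= kf <-]; exists k => // x.
apply: le_trans (kf x) _; rewrite !patchE; case: ifPn => //.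
by rewrite inE; exact: fg.
Qed.

(** Finite sets of times bound [expected_sup] from below under both branches of its convention, so
    the countability of T no longer matters. *)
Lemma expected_sup_on_le (R : realType) (T : set R) (T0 : T 0%R)
    (d : measure_display) (Om : measurableType d) (P : probability Om R)
    (X : index_set T0 -> {RV P >-> R}) (F : set (index_set T0)) :
  finite_set F -> F point -> expected_sup_on X F <= expected_sup X.
Proof.
move=> finF Fp; rewrite /expected_sup; case: ifPn => _.
  apply: ge0_le_integral_pointwise => w _.
    apply: ereal_sup_ubound; exists point => //.
    by rewrite subrr normr0 expr0n.
  by apply: le_ereal_sup => _ [t Ft <-]; exists t.
by apply: ereal_sup_ubound; exists F.
Qed.

End pointwise_monotonicity.

(** * The orthogonal process built from two Haar systems *)

Section process.
Local Open Scope ereal_scope.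
Local Open Scope ring_scope.
Variables (R : realType) (T : set R) (T0 : T 0) (n : nat) (p : nat -> R).
Hypotheses (n_gt0 : (0 < n)%N) (p_ge0 : forall j, 0 <= p j).
Hypothesis p_sum1 : \sum_(j < n) p j = 1.
Variables (x : index_set T0 -> R) (L : R).
Hypotheses (L_gt0 : 0 < L) (x01 : forall t, 0 <= x t <= 1).
Hypothesis xL : forall s t, `|\val s - \val t| = L * `|x s - x t|.
Variables (J : finType) (A : {set J}) (f h : J -> 'I_n -> R).
Hypothesis f_orth : orthonormal_on (fun=> n%:R^-1) A f.
Hypothesis h_orth : orthonormal_on (fun j : 'I_n => p j) A h.

(** The inner product in L^2(dx) of the indicator of [0, x t] with the step function [f a]. *)
Definition haar_coef a t := \sum_j f a j * below_in_cell n (x t) j.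

Let X t : R -> R := step_rv (fun j => \sum_(a in A) haar_coef a t * h a j)
  (fun j => \sum_(a in A) haar_coef a t * f a j) (x t).

Let n0 : 0 < n%:R :> R. Proof. by rewrite ltr0n. Qed.

Lemma sum_below_in_cell (y : R) : 0 <= y <= 1 -> \sum_(j < n) below_in_cell n y j = y.
Proof.
move=> /andP[y0 y1]; rewrite -(big_mkord xpredT (below_in_cell n y)).
rewrite telescope_sumr ?leq0n// mul0r divff ?gt_eqF//.
by rewrite (min_idPl y1) (min_idPr y0) subr0.
Qed.

(** With [c] the increment of the coefficients, Parseval for [h] gives the sum of the [c a ^+ 2] on
    the atoms. The residual on the cells loses exactly this sum, so only the length of the time
    interval remains. *)
Lemma second_moment (P : probability (measurableTypeR R) R) s t :
  (forall j, (j < n)%N -> P (atom j) = (p j / 2)%:E) ->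
  (forall A : set (measurableTypeR R), measurable A ->
      A `<=` `[0, 1] -> P A = ((2^-1)%:E * lebesgue_measure A)%E) ->
  'E_P[fun u => (X s u - X t u) ^+ 2] = (2^-1 * `|x s - x t|)%:E.
Proof.
move=> Patom Pcell; wlog ts : s t / x t <= x s.
  move=> H; have [|/ltW st] := leP (x t) (x s); first exact: H.
  rewrite distrC -(H t s st); congr ('E_P[_]); apply/funext => u.
  by rewrite -sqrrN opprB.
rewrite (second_moment_step_rvB _ _ _ _ ts Patom Pcell) /=.
rewrite ger0_norm ?subr_ge0//; congr ((_ * _)%:E).
pose c a := haar_coef a s - haar_coef a t.
pose l (j : 'I_n) := below_in_cell n (x s) j - below_in_cell n (x t) j.
have cE : {in A, forall a, c a = \sum_i f a i * l i}.
  move=> a _; rewrite /c /haar_coef -sumrB; apply: eq_bigr => j _.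
  by rewrite -mulrBr.
have sumB (g : J -> 'I_n -> R) j : \sum_(a in A) haar_coef a s * g a j -
    \sum_(a in A) haar_coef a t * g a j = \sum_(a in A) c a * g a j.
  by rewrite -sumrB; apply: eq_bigr => a _; rewrite mulrBl.
under eq_bigr do rewrite sumB.
rewrite (parseval c h_orth).
under eq_bigr do rewrite sumB.
rewrite (sqnorm_residual f_orth cE) addrC subrK.
by rewrite sumrB !sum_below_in_cell.
Qed.

Lemma measurable_scaled_process t :
  measurable_fun [set: measurableTypeR R] (fun u => Num.sqrt (2 * L) * X t u).
Proof. by apply: measurable_funM => //; exact: measurable_step_rv. Qed.

Lemma exists_orthogonal_process :
  exists (P : probability (measurableTypeR R) R) (Y : index_set T0 -> {RV P >-> R}),
    orthogonal_process Y /\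
    forall tt : 'I_n -> index_set T0,
    ((L * \sum_(j < n) p j *
      (\sum_(a in A) (haar_coef a (tt j) - haar_coef a point) * h a j) ^+ 2)%:E
      <= expected_sup Y)%E.
Proof.
have [P [Patom Pcell]] := exists_atoms_uniform p_ge0 p_sum1.
(* The factor [Num.sqrt (2 * L)] makes up for the mass 1/2 of each half of the space and for the
   rescaling of time by [L]. *)
pose Y t : {RV P >-> R} := mfun_Sub (mem_set (measurable_scaled_process t)).
have L20 : 0 <= 2 * L by rewrite mulr_ge0// ltW.
exists P, Y; split.
  move=> s t; rewrite xL.
  transitivity ('E_P[fun u => (2 * L) * (X s u - X t u) ^+ 2]).
    congr ('E_P[_]); apply/funext => u /=.
    by rewrite -mulrBr exprMn sqr_sqrtr.
  have := @second_moment P s t Patom Pcell; rewrite unlock => M.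
  under eq_integral do rewrite EFinM.
  rewrite ge0_integralZl_EFin//.
  - by rewrite [X in (_ * X)%E]M -EFinM; congr (_%:E); field.
  - by move=> u _; rewrite lee_fin sqr_ge0.
  - apply/measurable_EFinP; apply: measurable_funX; apply: measurable_funB;
    exact: measurable_step_rv.
(* Only the times [tt j] and time 0 enter, with [tt j] used at the atom of index [j]. *)
move=> tt; pose F := point |` range tt.
have finF : finite_set F.
  by rewrite finite_setU; split => //; exact: finite_image.
apply: le_trans (expected_sup_on_le Y finF _); last by left.
pose k (j : 'I_n) := (Y (tt j) (- j.+1%:R) - Y point (- j.+1%:R)) ^+ 2.
have -> : ((L * \sum_(j < n) p j *
      (\sum_(a in A) (haar_coef a (tt j) - haar_coef a point) * h a j) ^+ 2)%:E
    = \sum_j (k j)%:E * P (atom j))%E.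
  under [RHS]eq_bigr do rewrite Patom// -EFinM.
  rewrite sumEFin; congr (_%:E); rewrite mulr_sumr; apply: eq_bigr => j _.
  rewrite /k /= -mulrBr exprMn sqr_sqrtr// /X !step_rv_atom -sumrB.
  by under eq_bigr do rewrite mulrBl; field.
rewrite -ge0_integral_sum_indic; last 2 first.
- by move=> j; exact: sqr_ge0.
- by move=> j; exact: measurable_atom.
apply: ge0_le_integral_pointwise => u _.
  by rewrite lee_fin; apply: sumr_ge0 => j _; rewrite mulr_ge0// sqr_ge0.
(* At an atom the sum reduces to the squared increment at time [tt i]; elsewhere it is 0, which is
   the contribution of time 0 to the supremum. *)
have [[i ->]|atomN] := pselect (exists i : 'I_n, u = - i.+1%:R).
  rewrite sum_atom_indic; apply: ereal_sup_ubound; exists (tt i).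
    by right; exists i.
  by rewrite real_normK ?num_real.
rewrite big1 => [|j _]; last first.
  by rewrite indicE memNset ?mulr0// => uj; apply: atomN; exists j.
apply: ereal_sup_ubound; exists point; first by left.
by rewrite subrr normr0 expr0n.
Qed.

End process.

(** * Masses of 4-adic cells *)

(** The function equal to [q / m1] on mass [m1] and to [- q / m3] on mass [m3] has mean zero; this
    is the [q] that gives it unit norm when both masses are positive. *)
Definition half_harmonic (R : rcfType) (m1 m3 : R) : R :=
  Num.sqrt (m1 * m3 / (m1 + m3)).

Lemma half_harmonic_min (R : rcfType) (m1 m3 : R) : 0 <= m1 -> m1 <= m3 ->
  Num.sqrt m1 <= Num.sqrt 2 * half_harmonic m1 m3.
Proof.
move=> m1_ge0 m13.
have m13E : m1 * (m1 + m3) <= 2 * (m1 * m3) by nra.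
rewrite -sqrtrM// ler_sqrt; last first.
  by rewrite mulr_ge0// divr_ge0 ?mulr_ge0 ?addr_ge0// (le_trans m1_ge0).
have [->|m1_neq0] := eqVneq m1 0; first by rewrite !mul0r mulr0.
have m1_gt0 : 0 < m1 by rewrite lt_def m1_neq0.
by rewrite mulrA ler_pdivlMr// ltr_wpDr// (le_trans m1_ge0).
Qed.

(** Cauchy-Schwarz, with 7/4 as a rational bound for the square root of 3. That it is below 2 leaves
    the gap exploited in [sqrt_mass_split]. *)
Lemma sqrt3_sum (R : rcfType) (x y z m : R) : 0 <= x -> 0 <= y -> 0 <= z ->
  x + y + z <= m ->
  Num.sqrt x + Num.sqrt y + Num.sqrt z <= 7 / 4 * Num.sqrt m.
Proof.
move=> x0 y0 z0 xyzm; have m0 : 0 <= m by lra.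
have sqr_le (a b c d : R) : 0 <= a -> 0 <= b -> 0 <= c -> 0 <= d ->
    a ^+ 2 + b ^+ 2 + c ^+ 2 <= d ^+ 2 -> a + b + c <= 7 / 4 * d.
  move=> a0 b0 c0 d0 abcd; rewrite -ler_sqr ?nnegrE ?addr_ge0 ?mulr_ge0//.
  have := sqr_ge0 (a - b); have := sqr_ge0 (a - c); have := sqr_ge0 (b - c).
  have := sqr_ge0 d; nra.
by apply: sqr_le; rewrite ?sqrtr_ge0 ?sqr_sqrtr.
Qed.

(* Unless the four masses are nearly equal, the left-hand side is absorbed by
   the gap between [sqrt m] and half the sum of the square roots. *)
Lemma sqrt_mass_split (R : rcfType) (m0 m1 m2 m3 m : R) :
  0 <= m0 -> 0 <= m1 -> 0 <= m2 -> 0 <= m3 -> m = m0 + m1 + m2 + m3 ->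
  Num.sqrt m <= 8 * (Num.sqrt m - 2^-1 * (Num.sqrt m0 + Num.sqrt m1 +
                                           Num.sqrt m2 + Num.sqrt m3)) +
                4 * Num.sqrt 2 * half_harmonic m1 m3.
Proof.
move=> m00 m10 m20 m30 mE.
have hC : half_harmonic m1 m3 = half_harmonic m3 m1.
  by rewrite /half_harmonic (mulrC m1) (addrC m1).
(* Set the smaller of [m1] and [m3] apart. The other three roots add up to at most 7/4 of
   [Num.sqrt m], so 8 times the gap is at least [Num.sqrt m] minus 4 times the root set apart, and
   [half_harmonic_min] bounds that root. *)
have [m13|/ltW m31] := leP m1 m3.
  have := half_harmonic_min m10 m13.
  have := @sqrt3_sum R m0 m2 m3 m m00 m20 m30; rewrite mE; lra.
have := half_harmonic_min m30 m31; rewrite -hC.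
have := @sqrt3_sum R m0 m1 m2 m m00 m10 m20; rewrite mE; lra.
Qed.

Lemma big_nat_mul4 (R : realType) (F : nat -> R) M :
  \sum_(i < 4 * M) F i =
  \sum_(i < M) (F (4 * i)%N + F (4 * i + 1)%N + F (4 * i + 2)%N + F (4 * i + 3)%N).
Proof.
rewrite -!(big_mkord xpredT) -(big_mkord xpredT
  (fun i => F (4 * i)%N + F (4 * i + 1)%N + F (4 * i + 2)%N + F (4 * i + 3)%N)).
elim: M => [|M IH]; first by rewrite muln0 !big_geq.
rewrite mulnS addnC addn4 !big_nat_recr//= IH -!addrA.
by congr (_ + (F _ + (F _ + (F _ + F _)))); lia.
Qed.

Section tree.
Variables (R : realType) (N : nat) (p : 'I_(4 ^ N) -> R).
Hypothesis p_ge0 : forall j, 0 <= p j.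

Lemma cell_mass_ge0 k i : 0 <= cell_mass p k i.
Proof. by apply: sumr_ge0 => j _; rewrite mulr_ge0. Qed.

Lemma cell_massS k i : (k < N)%N -> cell_mass p k i =
  cell_mass p k.+1 (4 * i) + cell_mass p k.+1 (4 * i + 1) +
  cell_mass p k.+1 (4 * i + 2) + cell_mass p k.+1 (4 * i + 3).
Proof.
move=> kN; rewrite /cell_mass -!big_split /=; apply: eq_bigr => j _.
rewrite -!mulrDr; congr (_ * _); rewrite (ancestorS _ kN) -!natrD; congr (_%:R).
set c := ancestor k.+1 j; lia.
Qed.

Lemma cell_mass00 : cell_mass p 0 0 = \sum_j p j.
Proof.
apply: eq_bigr => j _; rewrite /ancestor subn0 divn_small//.
by rewrite eqxx mulr1.
Qed.

Definition level_sum k : R :=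
  2 ^- k * \sum_(i < 4 ^ k) Num.sqrt (cell_mass p k i).

Definition haar_weight k i : R :=
  half_harmonic (cell_mass p k.+1 (4 * i + 1)) (cell_mass p k.+1 (4 * i + 3)).

(** This is [sqrt_mass_split] summed over the cells of a level; its factor 1/2 is the ratio of the
    weights of consecutive levels. *)
Lemma level_sum_step k : (k < N)%N ->
  level_sum k <= 8 * (level_sum k - level_sum k.+1) +
    4 * Num.sqrt 2 * (2 ^- k * \sum_(i < 4 ^ k) haar_weight k i).
Proof.
move=> kN.
have -> : level_sum k.+1 = 2 ^- k * \sum_(i < 4 ^ k) (2^-1 *
   (Num.sqrt (cell_mass p k.+1 (4 * i)) + Num.sqrt (cell_mass p k.+1 (4 * i + 1)) +
    Num.sqrt (cell_mass p k.+1 (4 * i + 2)) + Num.sqrt (cell_mass p k.+1 (4 * i + 3)))).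
  rewrite /level_sum expnS (big_nat_mul4 (fun i => Num.sqrt (cell_mass p k.+1 i))).
  by rewrite -mulr_sumr exprS invfM mulrA (mulrC _ (2 ^- k)).
rewrite /level_sum -mulrBr -sumrB mulrCA [X in _ + X]mulrCA -mulrDr.
rewrite ler_wpM2l ?invr_ge0 ?exprn_ge0// !mulr_sumr -big_split /=.
apply: ler_sum => i _.
by apply: sqrt_mass_split; rewrite ?cell_mass_ge0//; exact: cell_massS.
Qed.

Lemma sum_level_sum : \sum_j p j = 1 ->
  \sum_(k < N) level_sum k <=
  8 + 4 * Num.sqrt 2 * \sum_(k < N) 2 ^- k * \sum_(i < 4 ^ k) haar_weight k i.
Proof.
move=> p1; rewrite mulr_sumr.
apply: (@le_trans _ _ (\sum_(k < N) 8 * (level_sum k - level_sum k.+1) +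
    \sum_(k < N) 4 * Num.sqrt 2 * (2 ^- k * \sum_(i < 4 ^ k) haar_weight k i))).
  by rewrite -big_split; apply: ler_sum => k _; exact: level_sum_step.
(* The gaps telescope to the level sum at 0, which is 1, minus a nonnegative one. *)
rewrite lerD2r -mulr_sumr -(big_mkord xpredT (fun k => level_sum k - level_sum k.+1)).
under eq_bigr do rewrite -opprB.
rewrite sumrN telescope_sumr// opprB.
rewrite -[leRHS]mulr1 ler_pM2l// /level_sum expr0 invr1 mul1r expn0 big_ord1.
rewrite cell_mass00 p1 sqrtr1 gerBl mulr_ge0 ?invr_ge0 ?exprn_ge0//.
by apply: sumr_ge0 => i _; rewrite sqrtr_ge0.
Qed.

End tree.

Section uniform_masses.
Variables (R : realType) (N : nat).
Local Notation n := (4 ^ N)%N.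
Local Notation unif := (fun _ : 'I_n => n%:R^-1 : R).

Lemma cell_mass_unif k i : (k <= N)%N -> (i < 4 ^ k)%N ->
  cell_mass unif k i = 4 ^- k.
Proof.
move=> kN i4; rewrite /cell_mass -mulr_sumr.
have nE : n = (4 ^ k * 4 ^ (N - k))%N by rewrite -expnD subnKC.
set d := (4 ^ (N - k))%N in nE *.
have d0 : (0 < d)%N by rewrite expn_gt0.
have -> : \sum_(j < n) (ancestor N k j == i)%:R = d%:R :> R.
  rewrite -(big_mkord xpredT (fun j => (ancestor N k j == i)%:R)).
  transitivity (\sum_(i * d <= j < i.+1 * d) 1 : R); last first.
    by rewrite big_const_nat -mulnBl subSnn mul1n iter_addr_0.
  have idn : (i.+1 * d <= n)%N by rewrite nE leq_mul2r i4 orbT.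
  rewrite [RHS](big_nat_widen _ _ n)//.
  rewrite [RHS](big_nat_widenl _ 0)// [RHS]big_mkcond /=.
  apply: eq_bigr => j _; rewrite /ancestor -/d.
  have -> : (j %/ d == i)%N = (j < i.+1 * d)%N && (i * d <= j)%N.
    by rewrite eqn_leq -ltnS ltn_divLR// leq_divRL.
  by case: ifP.
rewrite nE natrM invfM natrX -mulrA mulVf ?mulr1//.
by rewrite pnatr_eq0 -lt0n.
Qed.

End uniform_masses.

(** The variance of [z] under [p] is nonnegative. *)
Lemma sqr_mean_le (R : realType) (I : finType) (p z : I -> R) :
  (forall i, 0 <= p i) -> \sum_i p i = 1 ->
  (\sum_i p i * z i) ^+ 2 <= \sum_i p i * z i ^+ 2.
Proof.
move=> p0 p1; set m := \sum_i p i * z i.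
have : 0 <= \sum_i p i * (z i - m) ^+ 2.
  by apply: sumr_ge0 => i _; rewrite mulr_ge0// sqr_ge0.
have -> : \sum_i p i * (z i - m) ^+ 2 =
    \sum_i (p i * z i ^+ 2 - 2 * m * (p i * z i) + m ^+ 2 * p i).
  by apply: eq_bigr => i _; ring.
rewrite !big_split /= sumrN -!mulr_sumr p1 -/m; lra.
Qed.

Lemma half_harmonic_sqr (R : rcfType) (m1 m3 : R) : 0 < m1 -> 0 < m3 ->
  half_harmonic m1 m3 ^+ 2 = m1 * m3 / (m1 + m3).
Proof.
by move=> m10 m30; rewrite sqr_sqrtr// divr_ge0 ?mulr_ge0 ?addr_ge0// ltW.
Qed.

(** * The Haar weights bounded by means of the orthogonal process *)

Section lower_bound.
Variables (R : realType) (T : set R) (T0 : T 0) (N : nat) (p : nat -> R).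
Local Notation n := (4 ^ N)%N.
Hypotheses (p_ge0 : forall j, 0 <= p j) (p_sum1 : \sum_(j < n) p j = 1).
Variables (x : index_set T0 -> R) (L : R).
Hypotheses (L_gt0 : 0 < L) (x01 : forall t, 0 <= x t <= 1).
Hypothesis xL : forall s t, `|\val s - \val t| = L * `|x s - x t|.
Variable tt : 'I_n -> index_set T0.
Hypothesis tt_leaf : forall j : 'I_n, 0 < p j ->
  j%:R / n%:R <= x (tt j) <= j.+1%:R / n%:R.

Let w (j : 'I_n) : R := p j.
Let J := ('I_N * 'I_n)%type.
Let m1 (a : J) := cell_mass w a.1.+1 (4 * a.2 + 1).
Let m3 (a : J) := cell_mass w a.1.+1 (4 * a.2 + 3).
Let q (a : J) := haar_weight w a.1 a.2.
(** All levels share the index type ['I_n], so indices beyond the level are cut off. Positive masses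
    in children 1 and 3 let [h] have unit norm; any other cell has Haar weight 0. *)
Let A : {set J} := [set a : J | [&& (a.2 < 4 ^ a.1)%N, 0 < m1 a & 0 < m3 a]].
(** Each child has uniform weight [4 ^- a.1.+1], so this value gives [f] unit norm. *)
Let c (a : J) : R := Num.sqrt 2 * 2 ^+ a.1.
Let f (a : J) := @haar R N 0 2 (c a) (c a) a.1 a.2.
Let h (a : J) := @haar R N 1 3 (q a / m1 a) (q a / m3 a) a.1 a.2.

Let n_gt0 : (0 < n)%N. Proof. by rewrite expn_gt0. Qed.
Let n0 : 0 < n%:R :> R. Proof. by rewrite ltr0n. Qed.

Let level_index_inj : injective (fun a : J => (a.1 : nat, a.2 : nat)).
Proof. by move=> [a1 a2] [b1 b2] [/val_inj -> /val_inj ->]. Qed.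

Let child_lt (a : J) b : a \in A -> (b < 4)%N -> (4 * a.2 + b < 4 ^ a.1.+1)%N.
Proof. by rewrite inE => /and3P[a2 _ _] b4; rewrite expnS; lia. Qed.

Lemma time_haar_orthonormal : orthonormal_on (fun=> n%:R^-1) A f.
Proof.
apply: haar_orthonormal => //; last 2 first.
- by move=> a aA; rewrite !cell_mass_unif ?child_lt//; case: a {aA} => -[].
- move=> a aA; rewrite !cell_mass_unif ?child_lt//; try exact: ltn_ord.
  have -> : c a ^+ 2 = 2 * 4 ^+ a.1.
    by rewrite exprMn sqr_sqrtr// exprAC expr2 -natrM.
  by rewrite exprS; field; rewrite expf_neq0.
Qed.

Lemma mass_haar_orthonormal : orthonormal_on w A h.
Proof.
apply: haar_orthonormal => //; last 2 first.
- move=> a; rewrite inE => /and3P[_ m10 m30].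
  by rewrite -/(m1 a) -/(m3 a) !divfK// gt_eqF.
- move=> a; rewrite inE => /and3P[_ m10 m30].
  rewrite -/(m1 a) -/(m3 a) !exprMn half_harmonic_sqr// -/(m1 a) -/(m3 a).
  by field; rewrite !gt_eqF//= addr_gt0.
Qed.

Lemma below_in_cell_leaf (y : R) (j0 : nat) : j0%:R / n%:R <= y <= j0.+1%:R / n%:R ->
  (forall j, (j < j0)%N -> below_in_cell n y j = n%:R^-1) /\
  (forall j, (j0 < j)%N -> below_in_cell n y j = 0).
Proof.
move=> /andP[jy yj]; split => j jj; rewrite /below_in_cell.
  have le1 : j.+1%:R / n%:R <= y :> R.
    by apply: le_trans jy; rewrite ler_pM2r ?invr_gt0// ler_nat.
  have le0 : j%:R / n%:R <= y :> R.
    by apply: le_trans le1; rewrite ler_pM2r ?invr_gt0// ler_nat.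
  by rewrite (min_idPr le1) (min_idPr le0) -mulrBl -natr1 addrC addKr mul1r.
have le0 : y <= j%:R / n%:R :> R.
  by apply: le_trans yj _; rewrite ler_pM2r ?invr_gt0// ler_nat.
have le1 : y <= j.+1%:R / n%:R :> R.
  by apply: le_trans le0 _; rewrite ler_pM2r ?invr_gt0// ler_nat.
by rewrite (min_idPl le1) (min_idPl le0) subrr.
Qed.

Let ancestor_lt k (i j : nat) : (ancestor N k i < ancestor N k j)%N -> (i < j)%N.
Proof. by apply: contraTT; rewrite -!leqNgt; exact: leq_div2r. Qed.

Let unif := fun _ : 'I_n => n%:R^-1 : R.

(** For a time in child 1, child 0 lies entirely before it and child 2 entirely after it. *)
Lemma haar_coef_child1 (a : J) t (j0 : nat) : a \in A ->
  j0%:R / n%:R <= x t <= j0.+1%:R / n%:R -> ancestor N a.1.+1 j0 = (4 * a.2 + 1)%N ->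
  haar_coef x f a t = c a * 4 ^- a.1.+1.
Proof.
move=> aA /below_in_cell_leaf[full empty] aj0.
rewrite -(@cell_mass_unif R N _ (4 * a.2 + 0)%N) ?child_lt//.
rewrite /cell_mass mulr_sumr; apply: eq_bigr => j _; rewrite /f /haar.
have [aj|_] := eqVneq (ancestor N a.1.+1 j) (4 * a.2 + 0)%N.
  rewrite full ?aj ?eqn_add2l /=.
    by rewrite mulr0 subr0 -mulrA (mulrC 1).
  by apply: (@ancestor_lt a.1.+1); rewrite aj aj0; lia.
have [aj|_] := eqVneq (ancestor N a.1.+1 j) (4 * a.2 + 2)%N.
  rewrite empty; first by rewrite !mulr0.
  by apply: (@ancestor_lt a.1.+1); rewrite aj aj0; lia.
by rewrite /= !mulr0 subrr mul0r.
Qed.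

Lemma haar_coef_child3 (a : J) t (j0 : nat) : a \in A ->
  j0%:R / n%:R <= x t <= j0.+1%:R / n%:R -> ancestor N a.1.+1 j0 = (4 * a.2 + 3)%N ->
  haar_coef x f a t = 0.
Proof.
move=> aA /below_in_cell_leaf[full empty] aj0.
(* Children 0 and 2 both lie before a time in child 3, so the coefficient is the full mean of [f a],
   which is 0. *)
have -> : 0 = \sum_j unif j * f a j.
  rewrite sum_haar !cell_mass_unif ?child_lt// ?subrr//; exact: ltn_ord.
apply: eq_bigr => j _; rewrite /f /haar mulrC.
have [aj|_] := eqVneq (ancestor N a.1.+1 j) (4 * a.2 + 0)%N.
  rewrite full//.
  by apply: (@ancestor_lt a.1.+1); rewrite aj aj0; lia.
have [aj|_] := eqVneq (ancestor N a.1.+1 j) (4 * a.2 + 2)%N; last by rewrite !mulr0 subrr !mulr0.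
rewrite full//.
by apply: (@ancestor_lt a.1.+1); rewrite aj aj0; lia.
Qed.

(** The term at time 0 drops out because [h a] has mean zero. Of the rest only child 1 contributes,
    where [h a] is [q a / m1 a] on mass [m1 a]. *)
Lemma haar_pairing (a : J) : a \in A ->
  \sum_(j < n) p j * ((haar_coef x f a (tt j) - haar_coef x f a point) * h a j) =
  q a * (c a * 4 ^- a.1.+1).
Proof.
move=> aA; have := aA; rewrite inE => /and3P[_ m10 m30].
transitivity (\sum_(j < n) (q a / m1 a * (c a * 4 ^- a.1.+1)) *
    (w j * (ancestor N a.1.+1 j == 4 * a.2 + 1)%N%:R) -
    haar_coef x f a point * \sum_(j < n) w j * h a j).
  rewrite mulr_sumr -sumrB; apply: eq_bigr => j _.
  (* Nothing is known about [tt j] in a leaf of mass zero, but such a leaf contributes 0 to both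
     sides. *)
  rewrite /w; have [pj0|pj] := eqVneq (p j) 0; first by rewrite pj0; ring.
  have /tt_leaf ttj : 0 < p j by rewrite lt_def pj p_ge0.
  have haar1 := haar_coef_child1 aA ttj.
  have haar3 := haar_coef_child3 aA ttj.
  rewrite /h /haar; move: haar1 haar3.
  move: (haar_coef x f a (tt j)) (haar_coef x f a point) (c a * _) => ct c0 K.
  move: (q a / m1 a) (q a / m3 a) (p j) => u v pj' haar1 haar3.
  have [aj|_] := eqVneq (ancestor N a.1.+1 j) (4 * a.2 + 1)%N.
    by rewrite haar1// aj eqn_add2l /=; ring.
  have [aj|_] := eqVneq (ancestor N a.1.+1 j) (4 * a.2 + 3)%N; last by rewrite /=; ring.
  by rewrite haar3//=; ring.
rewrite sum_haar -/(m1 a) -/(m3 a) !divfK ?gt_eqF// subrr mulr0 subr0.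
by rewrite -mulr_sumr -/(cell_mass w _ _) -/(m1 a) mulrAC divfK// gt_eqF.
Qed.

(** Jensen bounds the second moment of the process at a random time from below by the square of its
    mean, and [haar_pairing] computes this mean cell by cell. *)
Lemma haar_weight_le (C : R) :
  (forall (d : measure_display) (Omega : measurableType d)
      (P : probability Omega R) (X : index_set T0 -> {RV P >-> R}),
    orthogonal_process X -> (expected_sup X <= C%:E)%E) ->
  Num.sqrt 2 / 4 * \sum_(k < N) 2 ^- k * \sum_(i < 4 ^ k) haar_weight w k i
    <= Num.sqrt (C / L).
Proof.
move=> HC.
have [P [Y [orthY]]] := exists_orthogonal_process n_gt0 p_ge0 p_sum1 L_gt0 x01 xL
  time_haar_orthonormal mass_haar_orthonormal.
move=> /(_ tt) /le_trans /(_ (HC _ _ _ _ orthY)); rewrite lee_fin => LC.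
have {}LC : (\sum_(a in A) q a * (c a * 4 ^- a.1.+1)) ^+ 2 <= C / L.
  rewrite ler_pdivlMr// mulrC; apply: le_trans LC; rewrite ler_pM2l//.
  pose z j := \sum_(a in A) (haar_coef x f a (tt j) - haar_coef x f a point) * h a j.
  apply: le_trans (@sqr_mean_le R _ w z (fun j => p_ge0 j) p_sum1).
  rewrite le_eqVlt; apply/orP; left; apply/eqP; congr (_ ^+ 2).
  under [RHS]eq_bigr do rewrite mulr_sumr.
  rewrite exchange_big /=; apply: eq_bigr => a aA.
  by rewrite haar_pairing.
apply: le_trans (ler_wsqrtr LC); rewrite sqrtr_sqr; apply: le_trans (ler_norm _).
rewrite le_eqVlt; apply/orP; left; apply/eqP; rewrite mulr_sumr.
have cE (k : nat) : Num.sqrt 2 * 2 ^+ k * 4 ^- k.+1 = Num.sqrt 2 / 4 * 2 ^- k :> R.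
  have -> : 4 ^+ k.+1 = 4 * (2 ^+ k * 2 ^+ k) :> R.
    by rewrite exprS -exprMn -natrM.
  by field; rewrite expf_neq0.
transitivity (\sum_(a : J | (a.2 < 4 ^ a.1)%N) q a * (c a * 4 ^- a.1.+1)).
  rewrite -(pair_big_dep xpredT (fun (k : 'I_N) (i : 'I_n) => (i < 4 ^ k)%N)
    (fun k i => q (k, i) * (c (k, i) * 4 ^- k.+1))) /=.
  apply: eq_bigr => k _.
  rewrite (big_ord_widen_cond n xpredT (fun i => haar_weight w k i)); last first.
    by rewrite leq_exp2l// ltnW.
  rewrite !mulr_sumr; apply: eq_bigr => i _.
  by rewrite /c /= cE mulrA mulrC.
(* Cells of the level outside [A] have a vanishing mass in child 1 or 3, hence weight 0. *)
rewrite [LHS]big_mkcond [RHS]big_mkcond; apply: eq_bigr => a _; rewrite inE.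
case: ifP => //= a4; case: ifP => // /negbT; rewrite negb_and -!leNgt => m13.
rewrite /q /haar_weight /half_harmonic -/(m1 a) -/(m3 a).
have [m10|m30] : m1 a = 0 \/ m3 a = 0.
- case/orP: m13 => m0; [left|right]; apply/eqP; rewrite eq_le m0;
  by apply: cell_mass_ge0 => j; exact: p_ge0.
- by rewrite m10 !mul0r sqrtr0 mul0r.
- by rewrite m30 mulr0 mul0r sqrtr0 mul0r.
Qed.

End lower_bound.

(** * The majorizing integral *)

Section entropy.
Variables (R : realType) (T : set R) (T0 : T 0) (D : R).
Hypotheses (D_gt0 : 0 < D) (diamD : forall s t, T s -> T t -> `|s - t| <= D).
Variable mu : probability (borel_index_set T0) R.

Let L : R := 4 * D.
Let L_gt0 : 0 < L. Proof. by rewrite mulr_gt0. Qed.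

(** As 0 lies in T, T is contained in [-D, D] and is mapped into [0, 1/2]. Staying below 1 keeps
    cell indices of level k below 4^k. *)
Definition coord (t : index_set T0) : R := (\val t + D) / (4 * D).

Let coordE t : \val t = L * coord t - D.
Proof. by rewrite /coord /L; field; rewrite gt_eqF. Qed.

Lemma coord01 t : 0 <= coord t < 1.
Proof.
have Tt : T (\val t) := set_mem (valP t).
have := diamD Tt T0; rewrite subr0 ler_norml => /andP[tl tr].
rewrite /coord; move: (\val t) tl tr => v tl tr.
rewrite divr_ge0 ?ltr_pdivrMr ?mulr_gt0//=; last by rewrite mulr_ge0// ltW.
  by have D0 := D_gt0; rewrite mul1r; lra.
by rewrite -lerBlDr sub0r.
Qed.

Lemma coord_dist s t : `|\val s - \val t| = L * `|coord s - coord t|.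
Proof.
rewrite !coordE -[L in RHS]gtr0_norm// -normrM; congr `|_|; ring.
Qed.

Definition cell_index k (t : index_set T0) : nat := Num.truncn (4 ^+ k * coord t).

Let coord_ge0 t : 0 <= coord t. Proof. by have /andP[] := coord01 t. Qed.

Let scaled_ge0 k t : 0 <= 4 ^+ k * coord t.
Proof. by apply: mulr_ge0 (coord_ge0 t); rewrite exprn_ge0. Qed.

Lemma cell_indexP k t : (cell_index k t)%:R <= 4 ^+ k * coord t < (cell_index k t).+1%:R.
Proof. exact: truncn_itv (scaled_ge0 k t). Qed.

Lemma cell_index_lt k t : (cell_index k t < 4 ^ k)%N.
Proof.
rewrite truncn_lt_nat ?scaled_ge0// natrX -[ltRHS]mulr1.
by rewrite ltr_pM2l ?exprn_gt0//; have /andP[] := coord01 t.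
Qed.

Lemma ancestor_cell_index N k t : (k <= N)%N -> ancestor N k (cell_index N t) = cell_index k t.
Proof.
move=> kN; apply/esym/truncn_def; rewrite /ancestor.
have /andP[lo hi] := cell_indexP N t; set d := (4 ^ (N - k))%N.
have dE : 4 ^+ N = d%:R * 4 ^+ k :> R by rewrite natrX -exprD subnK.
have d0 : 0 < d%:R :> R by rewrite ltr0n expn_gt0.
rewrite dE -mulrA in lo hi.
apply/andP; split.
  have : d%:R * (cell_index N t %/ d)%N%:R <= d%:R * (4 ^+ k * coord t).
    by apply: le_trans lo; rewrite -natrM ler_nat mulnC leq_trunc_div.
  by rewrite ler_pM2l.
have : d%:R * (4 ^+ k * coord t) < d%:R * (cell_index N t %/ d).+1%:R.
  apply: lt_le_trans hi _; rewrite -natrM ler_nat mulnC.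
  by rewrite ltn_ceil// expn_gt0.
by rewrite ltr_pM2l.
Qed.

Definition index_cell k i : set (borel_index_set T0) := [set t | cell_index k t = i].

Lemma open_measurable_borel (U : set (index_set T0)) :
  open U -> measurable (U : set (borel_index_set T0)).
Proof. exact: sub_sigma_algebra. Qed.

(** A cell is the difference of two relatively open half-lines. *)
Lemma measurable_index_cell k i : measurable (index_cell k i).
Proof.
pose below (b : R) : set (index_set T0) := [set t | \val t < b].
have mbelow b : measurable (below b : set (borel_index_set T0)).
  apply: open_measurable_borel.
  have -> : below b = (fun t : index_set T0 => \val t : R) @^-1` `]-oo, b[%classic.
    by apply/seteqP; split => t /=; rewrite in_itv.
  apply: open_comp => // t _; exact: initial_continuous.
have -> : index_cell k i = (below (L * (i.+1%:R / 4 ^+ k) - D) : set (borel_index_set T0))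
    `\` below (L * (i%:R / 4 ^+ k) - D).
  have k4 : 0 < 4 ^+ k :> R by rewrite exprn_gt0.
  apply/seteqP; split => t.
    rewrite /index_cell /below /= => ti; have := cell_indexP k t; rewrite ti => /andP[lo hi].
    rewrite !coordE !ltrD2r !ltr_pM2l// ltr_pdivlMr// ltr_pdivlMr// mulrC.
    by rewrite hi; split => //; apply/negP; rewrite -leNgt.
  rewrite /index_cell /below /= !coordE !ltrD2r !ltr_pM2l// ltr_pdivlMr// ltr_pdivlMr// mulrC.
  move=> [hi /negP]; rewrite -leNgt => lo; apply: truncn_def; rewrite lo hi //.
exact: measurableD.
Qed.

Definition mass k i : R := fine (mu (index_cell k i)).

Lemma mass_ge0 k i : 0 <= mass k i.
Proof. by rewrite fine_ge0. Qed.

Lemma massE k i : mu (index_cell k i) = (mass k i)%:E.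
Proof. by rewrite fineK// fin_num_measure//; exact: measurable_index_cell. Qed.

Lemma sum_mass_cond N (phi : pred nat) (S : set (borel_index_set T0)) :
  measurable S -> (forall t, S t <-> phi (cell_index N t)) ->
  \sum_(j < 4 ^ N) mass N j * (phi j)%:R = fine (mu S).
Proof.
move=> mS SE; apply: EFin_inj; rewrite fineK ?fin_num_measure//.
have <- : (\int[mu]_t (\1_S t)%:E)%E = mu S by rewrite integral_indic// setIT.
transitivity (\int[mu]_t (\sum_(j < 4 ^ N) (phi j)%:R * \1_(index_cell N j) t)%:E)%E.
  rewrite ge0_integral_sum_indic//; last by move=> j; exact: measurable_index_cell.
  rewrite -sumEFin; apply: eq_bigr => j _; rewrite EFinM muleC.
  by congr (_ * _)%E; exact/esym/massE.
apply: eq_integral => t _; congr (_%:E).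
rewrite (bigD1 (Ordinal (cell_index_lt N t)))//= big1 => [|j /eqP jt].
  rewrite !indicE mem_set// mulr1 addr0; congr ((_ : bool)%:R).
  by apply/idP/idP; rewrite inE => /SE.
rewrite indicE memNset ?mulr0// => tj; apply: jt; exact: val_inj.
Qed.

Lemma sum_mass N : \sum_(j < 4 ^ N) mass N j = 1.
Proof.
transitivity (\sum_(j < 4 ^ N) mass N j * (xpredT (j : nat))%:R).
  by apply: eq_bigr => j _; rewrite mulr1.
rewrite (@sum_mass_cond N xpredT setT)//.
by have -> : mu setT = 1%E by exact: probability_setT.
Qed.

Lemma cell_mass_mass N k i : (k <= N)%N ->
  cell_mass (fun j : 'I_(4 ^ N) => mass N j) k i = mass k i.
Proof.
move=> kN; apply: (@sum_mass_cond N (fun j => ancestor N k j == i)).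
  exact: measurable_index_cell.
by move=> t; rewrite ancestor_cell_index//; split => /eqP.
Qed.

Lemma entropy_partial_sum_le (C : R) (N : nat) :
  (forall (d : measure_display) (Omega : measurableType d)
      (P : probability Omega R) (X : index_set T0 -> {RV P >-> R}),
    orthogonal_process X -> (expected_sup X <= C%:E)%E) ->
  \sum_(k < N) 2 ^- k * \sum_(i < 4 ^ k) Num.sqrt (mass k i) <=
  8 + 16 * Num.sqrt (C / L).
Proof.
move=> HC; pose p := mass N.
(* Some time in each cell; the default [point] is taken only in empty cells, which have mass
   zero. *)
pose tt (j : 'I_(4 ^ N)) : index_set T0 := xget point (index_cell N j).
have tt_leaf (j : 'I_(4 ^ N)) : 0 < p j ->
    j%:R / (4 ^ N)%:R <= coord (tt j) <= j.+1%:R / (4 ^ N)%:R.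
  move=> pj; have /(xgetPex (point : index_set T0)) : exists t, index_cell N j t.
    apply: contrapT => /forallNP noj; move: pj; rewrite /p /mass.
    have -> : index_cell N j = set0 by apply/seteqP; split => // t /noj.
    by rewrite measure0 ltxx.
  rewrite -/(tt j) => ttj; have := cell_indexP N (tt j); rewrite ttj => /andP[lo hi].
  have n4 : 0 < 4 ^+ N :> R by rewrite exprn_gt0.
  by rewrite natrX ler_pdivrMr// ler_pdivlMr// mulrC lo ltW.
have x01 t : 0 <= coord t <= 1 by have /andP[-> /ltW] := coord01 t.
have := haar_weight_le (mass_ge0 N) (sum_mass N) L_gt0 x01 coord_dist tt_leaf HC.
have := @sum_level_sum R N (fun j => p j) (fun j => mass_ge0 N j) (sum_mass N).
have -> : \sum_(k < N) level_sum (fun j : 'I_(4 ^ N) => p j) k =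
    \sum_(k < N) 2 ^- k * \sum_(i < 4 ^ k) Num.sqrt (mass k i).
  apply: eq_bigr => k _; congr (_ * _); apply: eq_bigr => i _.
  by rewrite cell_mass_mass// ltnW.
rewrite /p; set Q := \sum_(k < N) _ * \sum_(i < _) haar_weight _ _ _ => H1 H2.
(* The constant 16 comes from writing [4 * Num.sqrt 2] as 16 times [Num.sqrt 2 / 4]. *)
by apply: le_trans H1 _; rewrite lerD2l; lra.
Qed.

End entropy.

(** Take the least [k] satisfying the first inequality; it is not 0 because [r < s]. *)
Lemma exists_dyadic_scale (R : realType) (s r : R) : 0 < r < s ->
  exists k : nat, s * 2 ^- k <= r < s * (2 * 2 ^- k).
Proof.
move=> /andP[r0 rs].
have exk : exists k, s * 2 ^- k <= r.
  exists (Num.truncn (s / r)).+1.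
  rewrite ler_pdivrMr ?exprn_gt0// mulrC -ler_pdivrMr//.
  apply/ltW/(lt_le_trans (truncnS_gt _)).
  by rewrite -natrX ler_nat ltnW// ltn_expl.
case: (ex_minnP exk) => -[|k] Pk min_k.
  by move: Pk; rewrite expr0 invr1 mulr1 leNgt rs.
exists k.+1; rewrite Pk /=.
have -> : 2 * 2 ^- k.+1 = 2 ^- k :> R.
  by rewrite exprS invfM mulrA divff ?mul1r// pnatr_eq0.
by rewrite ltNge; apply/negP => /min_k; rewrite ltnn.
Qed.

(** * From the level sums to the majorizing integral *)

Section majorizing.
Variables (R : realType) (T : set R) (T0 : T 0) (D : R).
Hypotheses (D_gt0 : 0 < D) (diamD : forall s t, T s -> T t -> `|s - t| <= D).
Variable mu : probability (borel_index_set T0) R.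
Local Notation cell_index := (@cell_index R T T0 D).
Local Notation index_cell := (@index_cell R T T0 D).
Local Notation mass := (@mass R T T0 D mu).

Let inv k i : \bar R := ((sqrte (mu (index_cell k i)))^-1)%E.
(** Twice the square root of the cell length [4 * D * 4 ^- k]: the upper end of the dyadic range of
    radii assigned to level [k]. *)
Let width (k : nat) : R := 4 * Num.sqrt D * 2 ^- k.

Let inv_ge0 k i : (0 <= inv k i)%E.
Proof. by rewrite inve_ge0 sqrte_ge0. Qed.

Let width_ge0 k : 0 <= width k.
Proof. by rewrite !mulr_ge0// invr_ge0 exprn_ge0. Qed.

Lemma measurable_cball (t : index_set T0) (e : R) :
  measurable (cball t e : set (borel_index_set T0)).
Proof.
have -> : cball t e = ~` [set s | e < `|\val s - \val t|].
  by apply/seteqP; split => s /=; rewrite /cball /= leNgt => /negP.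
apply: measurableC; apply: open_measurable_borel.
have -> : [set s : index_set T0 | e < `|\val s - \val t|] =
    (fun s : index_set T0 => \val s : R) @^-1` [set y | e < `|y - \val t|].
  by [].
apply: open_comp => [s _|]; first exact: initial_continuous.
have -> : [set y | e < `|y - \val t|] = (fun y => `|y - \val t|) @^-1` `]e, +oo[%classic.
  by apply/seteqP; split => y /=; rewrite in_itv /= andbT.
apply: open_comp => // y _; apply: cvg_norm.
by apply: cvgB; [exact: cvg_id|exact: cvg_cst].
Qed.

Lemma index_cell_sub_cball k (t : index_set T0) (r : R) :
  2 * Num.sqrt D * 2 ^- k <= r -> index_cell k (cell_index k t) `<=` cball t (r ^+ 2).
Proof.
move=> kr s sk; rewrite /cball /= (coord_dist T0 D_gt0).
have r2 : 4 * D * 4 ^- k <= r ^+ 2.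
  have -> : 4 * D * 4 ^- k = (2 * Num.sqrt D * 2 ^- k) ^+ 2.
    have -> : 4 ^+ k = 2 ^+ k * 2 ^+ k :> R by rewrite -exprMn -natrM.
    by rewrite -[D in LHS](sqr_sqrtr (ltW D_gt0)); field; rewrite expf_neq0.
  by rewrite ler_pXn2r// nnegrE ?(le_trans _ kr)// !mulr_ge0// invr_ge0 exprn_ge0.
apply: le_trans r2; rewrite ler_pM2l ?mulr_gt0//.
have k4 : 0 < 4 ^+ k :> R by rewrite exprn_gt0.
rewrite -(ler_pM2l k4) divff ?gt_eqF//.
have := cell_indexP D_gt0 diamD k (s : index_set T0); have := cell_indexP D_gt0 diamD k t.
have -> : cell_index k s = cell_index k t by [].
rewrite -[(cell_index k t).+1%:R]natr1.
move: (coord D s) (coord D t) => a b /andP[t1 t2] /andP[s1 s2].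
have -> : 4 ^+ k * `|a - b| = `|4 ^+ k * a - 4 ^+ k * b|.
  by rewrite -mulrBr normrM (gtr0_norm k4).
by rewrite ler_norml; apply/andP; split; lra.
Qed.

(* The term at 0 dominates the integrand where [mu [set t]] may vanish. *)
Let G (t : index_set T0) (r : R) : \bar R :=
  (+oo * (\1_[set 0%R] r)%:E +
   \sum_(k <oo) inv k (cell_index k t) * (\1_(`[0%R, width k]%classic) r)%:E)%E.

Let term_ge0 t k r : (0 <= inv k (cell_index k t) * (\1_(`[0%R, width k]%classic) r)%:E)%E.
Proof. by rewrite mule_ge0// lee_fin. Qed.

Lemma integrand_le (t : index_set T0) (r : R) : 0 <= r <= Num.sqrt D ->
  ((sqrte (mu (cball t (r ^+ 2))))^-1 <= G t r)%E.
Proof.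
move=> /andP[]; rewrite le_eqVlt => /predU1P[<- _|r0 rD].
  rewrite /G indicE mem_set// mule1 addye ?leey//.
  by rewrite -ltNye (lt_le_trans ltNy0)//; exact: nneseries_ge0.
(* At this level the cell of [t] lies in the ball, so its inverse root mass dominates the integrand,
   and [r] is at most [width k]. *)
have [k /andP[kr rk]] : exists k : nat,
    2 * Num.sqrt D * 2 ^- k <= r < 2 * Num.sqrt D * (2 * 2 ^- k).
  apply: exists_dyadic_scale; rewrite r0 (le_lt_trans rD)//.
  by rewrite ltr_pMl ?sqrtr_gt0// ltr1n.
have inv_le : ((sqrte (mu (cball t (r ^+ 2))))^-1 <= inv k (cell_index k t))%E.
  rewrite /inv lee_pV2 ?inE ?sqrte_ge0// lee_sqrt// le_measure// ?inE.
  - exact: measurable_index_cell.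
  - exact: measurable_cball.
  - exact: index_cell_sub_cball.
have rw : \1_(`[0, width k]%classic) r = 1 :> R.
  rewrite indicE mem_set//= in_itv /= ltW//= ltW// (lt_le_trans rk)// /width.
  by rewrite mulrA -(mulrA 2) mulrCA -[4]/(2 * 2)%:R natrM; lra.
apply: (le_trans inv_le); rewrite /G -[leLHS]add0e.
apply: leeD; first by rewrite mule_ge0// lee_fin.
apply: le_trans (nneseries_lim_ge k.+1 _); last by move=> i _ _; exact: term_ge0.
rewrite big_nat_recr//= rw mule1 leeDr//.
by apply: sume_ge0 => i _; exact: term_ge0.
Qed.

Lemma integral_G (t : index_set T0) :
  (\int[lebesgue_measure]_r G t r = \sum_(k <oo) inv k (cell_index k t) * (width k)%:E)%E.
Proof.
have mindic (A : set (measurableTypeR R)) : measurable A ->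
    measurable_fun setT (fun r => (\1_A r)%:E : \bar R).
  by move=> mA; apply/measurable_EFinP; exact: measurable_indic.
have mterm k : measurable_fun [set: measurableTypeR R]
    (fun r => inv k (cell_index k t) * (\1_(`[0%R, width k]%classic) r)%:E)%E.
  by apply: measurable_funeM; apply: mindic; exact: measurable_itv.
have mzero : measurable (set1 0 : set (measurableTypeR R)).
  exact: measurable_set1.
have mpeak : measurable_fun [set: measurableTypeR R]
    (fun r => (+oo : \bar R) * (\1_[set 0%R] r)%:E)%E.
  by apply: measurable_funeM; exact: mindic.
have peak_ge0 (r : R) : (0 <= (+oo : \bar R) * (\1_[set 0%R] r)%:E)%E.
  by rewrite mule_ge0// lee_fin.
have mseries : measurable_fun [set: measurableTypeR R] (fun r =>
    \sum_(k <oo) inv k (cell_index k t) * (\1_(`[0%R, width k]%classic) r)%:E)%E.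
  by apply: ge0_emeasurable_sum => // k r _ _; exact: term_ge0.
have series_ge0 (r : R) : (0 <=
    \sum_(k <oo) inv k (cell_index k t) * (\1_(`[0%R, width k]%classic) r)%:E)%E.
  by apply: nneseries_ge0 => k _ _; exact: term_ge0.
rewrite ge0_integralD//.
rewrite ge0_integralZl//; last exact: mindic.
rewrite integral_indic//.
(* The infinite peak sits on a null set and integrates to 0. *)
rewrite setIT (_ : _ [set 0%R] = 0%E); last exact: lebesgue_measure_set1.
rewrite mule0 add0e.
rewrite integral_nneseries//.
apply: eq_eseriesr => k _.
have mI : measurable (`[0%R, width k]%classic : set (measurableTypeR R)).
  exact: measurable_itv.
rewrite ge0_integralZl//; last exact: mindic.
rewrite integral_indic// setIT; congr (_ * _)%E.
rewrite [LHS]lebesgue_measure_itv /= lte_fin.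
have := width_ge0 k; rewrite le_eqVlt => /predU1P[<-|->]; first by rewrite ltxx.
by rewrite sube0.
Qed.

Lemma invM_mass k i : (inv k i * mu (index_cell k i) = (Num.sqrt (mass k i))%:E)%E.
Proof.
rewrite /inv (massE D_gt0 diamD) /=; have m0 := mass_ge0 D mu k i.
(* For a null cell the left-hand side is +oo times 0, which is 0. *)
have [m_eq0|m_neq0] := eqVneq (mass k i) 0.
  by rewrite m_eq0 mule0 sqrtr0.
have sm0 : 0 < Num.sqrt (mass k i) by rewrite sqrtr_gt0 lt_def m_neq0.
rewrite inver gt_eqF// -EFinM -[X in _ * X]sqr_sqrtr// expr2 mulrA mulVf ?mul1r//.
by rewrite gt_eqF.
Qed.

(** This finite sum over cells yields both measurability in [t] and the integral over [mu]. *)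
Lemma inv_cell_indexE k (t : borel_index_set T0) :
  inv k (cell_index k t) = (\sum_(i < 4 ^ k) inv k i * (\1_(index_cell k i) t)%:E)%E.
Proof.
rewrite (bigD1 (Ordinal (cell_index_lt D_gt0 diamD k t)))//= big1 => [|i /eqP it].
  by rewrite indicE mem_set// mule1 adde0.
rewrite indicE memNset ?mule0// => ti; apply: it; exact: val_inj.
Qed.

Lemma measurable_inv_cell_index k :
  measurable_fun [set: borel_index_set T0] (fun t => inv k (cell_index k t)).
Proof.
under eq_fun do rewrite inv_cell_indexE.
apply: emeasurable_sum => i; apply: measurable_funeM; apply/measurable_EFinP.
by apply: measurable_indic; exact: measurable_index_cell.
Qed.

Lemma integral_inv_cell_index k : (\int[mu]_t inv k (cell_index k t) =
  (\sum_(i < 4 ^ k) Num.sqrt (mass k i))%:E)%E.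
Proof.
under eq_integral do rewrite inv_cell_indexE.
have mind i : measurable_fun [set: borel_index_set T0]
    (fun t => (\1_(index_cell k i) t)%:E : \bar R).
  by apply/measurable_EFinP; apply: measurable_indic; exact: measurable_index_cell.
rewrite ge0_integral_sum//; last 2 first.
- by move=> i; apply: measurable_funeM.
- by move=> i t _; rewrite mule_ge0// lee_fin.
rewrite -sumEFin; apply: eq_bigr => i _.
rewrite ge0_integralZl//.
by rewrite integral_indic ?setIT ?invM_mass//; exact: measurable_index_cell.
Qed.

Lemma majorizing_integral_le (B : R) : diam T = D%:E ->
  (forall N, \sum_(k < N) 2 ^- k * \sum_(i < 4 ^ k) Num.sqrt (mass k i) <= B) ->
  (majorizing_integral mu <= (4 * Num.sqrt D * B)%:E)%E.
Proof.
move=> diamE HB; rewrite /majorizing_integral diamE /=.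
apply: (@le_trans _ _ (\int[mu]_t \sum_(k <oo) inv k (cell_index k t) * (width k)%:E)%E).
  apply: ge0_le_integral_pointwise => t _.
    by apply: integral_ge0 => r _; rewrite inve_ge0 sqrte_ge0.
  (* The integral over radii up to [Num.sqrt D] is extended by 0 to the line, where [G] is
     nonnegative. *)
  rewrite -integral_G integral_mkcond; apply: ge0_le_integral_pointwise => r _.
    by apply: erestrict_ge0 => ? _; rewrite inve_ge0 sqrte_ge0.
  rewrite patchE; case: ifPn => [|_].
    by rewrite inE /= !lee_fin; exact: integrand_le.
  rewrite adde_ge0 ?mule_ge0 ?lee_fin//.
  by apply: nneseries_ge0 => k _ _; exact: term_ge0.
rewrite integral_nneseries//; last 2 first.
- move=> k; under eq_fun do rewrite muleC.
  exact: measurable_funeM (measurable_inv_cell_index k).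
- by move=> k t _; rewrite mule_ge0// lee_fin.
have -> : (\sum_(k <oo) \int[mu]_t (inv k (cell_index k t) * (width k)%:E) =
    \sum_(k <oo) (width k * \sum_(i < 4 ^ k) Num.sqrt (mass k i))%:E)%E.
  apply: eq_eseriesr => k _; under eq_integral do rewrite muleC.
  rewrite ge0_integralZl ?lee_fin//; last exact: measurable_inv_cell_index.
  by rewrite integral_inv_cell_index.
apply: lime_le.
  apply: is_cvg_nneseries => k _ _; rewrite lee_fin mulr_ge0//.
  by apply: sumr_ge0 => i _; rewrite sqrtr_ge0.
apply: nearW => N; rewrite big_mkord sumEFin lee_fin.
apply: le_trans (_ : _ <= 4 * Num.sqrt D *
    \sum_(k < N) 2 ^- k * \sum_(i < 4 ^ k) Num.sqrt (mass k i)) _.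
  by rewrite mulr_sumr; apply: ler_sum => k _; rewrite mulrA.
by rewrite ler_wpM2l// mulr_ge0.
Qed.

End majorizing.

(** * Infinite, zero and positive finite diameter *)

Local Open Scope ereal_scope.

Theorem theorem4 (R : realType) (T : set R) (T0 : T 0%R) :
  (exists C : R,
     forall (d : measure_display) (Omega : measurableType d)
            (P : probability Omega R) (X : index_set T0 -> {RV P >-> R}),
       orthogonal_process X -> expected_sup X <= C%:E) ->
  exists K : R, majorizing_sup T0 <= K%:E * diam T.
Proof.
move=> [C HC].
have dist_le s t : T s -> T t -> (`|s - t|)%:E <= diam T.
  by move=> Ts Tt; apply: ereal_sup_ubound; exists s => //; exists t.
have diam_ge0 : 0 <= diam T.
  by apply: le_trans (dist_le _ _ T0 T0); rewrite lee_fin.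
(* For infinite diameter the right-hand side is +oo with K = 1. *)
case diamE : (diam T) diam_ge0 => [D||]// D_ge0; last first.
  by exists 1%R; rewrite mul1e leey.
have dist_leD s t : T s -> T t -> (`|s - t| <= D)%R.
  by move=> Ts Tt; rewrite -lee_fin -diamE dist_le.
(* For zero diameter the radii form the null set {0}, so even an infinite integrand contributes
   nothing. *)
move: D_ge0; rewrite lee_fin le_eqVlt => /predU1P[D0|D_gt0].
  exists 0%R; rewrite mul0e; apply: ge_ereal_sup => _ [mu _ <-].
  rewrite /majorizing_integral diamE -D0 /= sqrtr0.
  apply: (@le_trans _ _ (\int[mu]_t cst 0 t)); last by rewrite integral0.
  apply: ge0_le_integral_pointwise => t _.
    by apply: integral_ge0 => r _; rewrite inve_ge0 sqrte_ge0.
  have -> : [set r : R | 0 <= r%:E <= 0%:E] = [set 0%R].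
    apply/seteqP; split => r /=; rewrite !lee_fin -eq_le; first by move=> /eqP.
    by move=> ->.
  apply: (@le_trans _ _ (\int[lebesgue_measure]_(r in [set 0%R]) cst +oo r)).
    apply: ge0_le_integral_pointwise => r _; first by rewrite inve_ge0 sqrte_ge0.
    exact: leey.
  rewrite integral_cst// (_ : _ [set 0%R] = 0) ?mule0//.
  exact: lebesgue_measure_set1.
(* The bound of [majorizing_integral_le] with the partial sums bounded by [entropy_partial_sum_le];
   K may depend on T, so it is divided by [D]. *)
pose M := (4 * Num.sqrt D * (8 + 16 * Num.sqrt (C / (4 * D))))%R.
exists (M / D)%R; rewrite -EFinM divfK ?gt_eqF//.
apply: ge_ereal_sup => _ [mu _ <-].
apply: (majorizing_integral_le D_gt0 dist_leD diamE) => N.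
exact: (entropy_partial_sum_le D_gt0 dist_leD mu N HC).
Qed.
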